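(* Let $3\le n\le m$ be integers and write $m=n+k$. For any $K\in\mathcal{P}(m,n)$, we have $\gamma(K)\le (n-1)(m-1)+1=m^2-(k+2)m+k+2$. Equality holds only if there exists a $K$-primitive matrix $A$ such that the digraph $(\mathcal{E},\mathcal{P}(A,K))$ is isomorphic to $F_1$.
   Context: A proper cone $K$ in $\mathbb{R}^n$ is a closed convex cone that is pointed ($K\cap(-K)=\{0\}$) and has nonempty interior. A face of $K$ is a subcone $F\subseteq K$ such that $y\in F$ whenever $x\in F$ and $y,x-y\in K$. For $x\in K$, $\Phi(x)$ is the smallest face of $K$ containing $x$. A nonzero $x\in K$ is an extreme vector if $\Phi(x)=\{\lambda x:\lambda\ge0\}$, which is then an extreme ray. A polyhedral cone is a proper cone with finitely many extreme rays; $\mathcal{P}(m,n)$ is the set of $n$-dimensional polyhedral cones with exactly $m$ extreme rays. $\pi(K)$ is the set of real matrices $A$ with $AK\subseteq K$. $A\in\pi(K)$ is $K$-primitive if $A^p(K\setminus\{0\})\subseteq\operatorname{int}K$ for some positive integer $p$; the least such $p$ is the exponent $\gamma(A)$. For polyhedral $K$, $\gamma(K)=\max\{\gamma(A):A\text{ is }K\text{-primitive}\}$. For $A\in\pi(K)$, $(\mathcal{E},\mathcal{P}(A,K))$ is the digraph whose vertices are the extreme rays of $K$, with an arc $(\Phi(x),\Phi(y))$ whenever $\Phi(y)\subseteq\Phi(Ax)$. $F_1$ is the digraph on vertices $x_1,\ldots,x_m$ with arcs $x_i\to x_{i+1}$ ($1\le i\le m-1$), $x_m\to x_1$ and $x_m\to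 x_2$. *)

(* Defs.v *)
From HB Require Import structures.
From mathcomp Require Import all_boot all_order all_algebra.
From mathcomp Require Import all_classical all_reals all_analysis.

Set Implicit Arguments.
Unset Strict Implicit.
Unset Printing Implicit Defensive.

Import Order.TTheory GRing.Theory Num.Theory.
Import numFieldNormedType.Exports.

Local Open Scope classical_set_scope.
Local Open Scope ring_scope.

Section Cones.
Context {R : realType} {n : nat}.
Implicit Types (K F C : set 'cV[R]_n) (x y : 'cV[R]_n) (A : 'M[R]_n).

Definition convex_cone C : Prop :=
  [/\ C 0,
      forall x y, C x -> C y -> C (x + y) &
      forall (a : R) x, 0 <= a -> C x -> C (a *: x)].

Definition proper_cone K : Prop :=
  [/\ convex_cone K,
      closed K,
      K `&` [set - x | x in K] = [set 0] &
      K° !=set0].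

Definition face K F : Prop :=
  [/\ convex_cone F,
      F `<=` K &
      forall x y, F x -> K y -> K (x - y) -> F y].

Definition Phi K x : set 'cV[R]_n := smallest (face K) [set x].

Definition extreme_vector K x : Prop :=
  [/\ K x, x != 0 & Phi K x = [set a *: x | a in [set a : R | 0 <= a]]].

Definition extreme_rays K : set (set 'cV[R]_n) :=
  [set Phi K x | x in extreme_vector K].

(* The class P(m, n); the nonempty interior makes K n-dimensional. *)
Definition polyhedral_cone (m : nat) K : Prop :=
  proper_cone K /\ (extreme_rays K #= `I_m)%card.

Definition cone_preserving K A : Prop := forall x, K x -> K (A *m x).

Definition primitive_powers K A : set nat :=
  [set p | (0 < p)%N /\ forall x, K x -> x != 0 -> K° (A ^+ p *m x)].

Definition K_primitive K A : Prop :=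
  cone_preserving K A /\ primitive_powers K A !=set0.

Definition is_min (S : set nat) (p : nat) : Prop := S p /\ lbound S p.
Definition is_max (S : set nat) (p : nat) : Prop := S p /\ ubound S p.

(* The default 0 is taken only when no power of A has the required property. *)
Definition exponent K A : nat := xget 0%N (is_min (primitive_powers K A)).

Definition exponents K : set nat := [set exponent K A | A in K_primitive K].

(* The default 0 would be taken if [exponents K] had no maximum; statements
   about [cone_exponent K] should therefore be read together with
   [is_max (exponents K) (cone_exponent K)]. *)
Definition cone_exponent K : nat := xget 0%N (is_max (exponents K)).

(* Arcs between faces E and F that are extreme rays, say E = Phi x and
   F = Phi y; whether Phi y is included in Phi (A x) does not depend on the
   choice of the representatives x and y. *)
Definition ray_arc K A (E F : set 'cV[R]_n) : Prop :=
  exists x y, [/\ extreme_vector K x, extreme_vector K y,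
    E = Phi K x, F = Phi K y & Phi K y `<=` Phi K (A *m x)].

End Cones.

(* Isomorphism of the digraph (V, e) with the digraph (V', e'), the vertex
   sets being subsets of the types T and T'. *)
Definition digraph_iso (T T' : Type) (V : set T) (e : T -> T -> Prop)
    (V' : set T') (e' : T' -> T' -> Prop) : Prop :=
  exists f : T -> T', set_bij V V' f /\
    forall u v, V u -> V v -> (e u v <-> e' (f u) (f v)).

(* Vertex x_(i+1) is the ordinal i. *)
Definition F1 (m : nat) (i j : 'I_m) : Prop :=
  [\/ j = i.+1 :> nat,
      i.+1 = m /\ j = 0%N :> nat |
      i.+1 = m /\ j = 1%N :> nat].

(* Main.v *)
(* Write y <= x when x - c y lies in K for some c > 0, i.e. when y is in the face
   of x. If x <= B x and some power of B maps x into the interior, the faces of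
   x, B x, B^2 x, ... increase strictly until they reach K; their dimensions
   bound the number of steps, so B^(n-1) x is interior. Applied to B = A^s this
   shows that A^(a + s (n-1)) x is interior as soon as the digraph has a walk of
   length a from x to a vertex on a circuit of length s ("lasso"). Choosing one
   out-arc at every vertex and iterating from x gives a lasso with a + s <= m.
   If A^((n-1)(m-1)) x is not interior, all these lassos must have a + s = m and
   a <= 1; modifying a choice of out-arcs at one vertex then rules out every arc
   outside F_1. The two arcs leaving the last vertex are both present, since a
   chain of vertices with a single out-arc is a chain of extreme rays mapped to
   one another, which never reach the interior. In F_1 the lasso a = 1,
   s = m - 1 gives the bound (n-1)(m-1) + 1. *)
Require Import Defs.
From HB Require Import structures.
From mathcomp Require Import all_boot all_order all_algebra.
From mathcomp Require Import all_classical all_reals all_analysis.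
From mathcomp Require Import ring lra zify.

Set Implicit Arguments.
Unset Strict Implicit.
Unset Printing Implicit Defensive.

Import Order.TTheory GRing.Theory Num.Theory.
Import numFieldNormedType.Exports.

Local Open Scope classical_set_scope.
Local Open Scope ring_scope.

(** A subspace of maximal dimension inside [S] is all of [S], since adjoining the line of a missed
    vector would raise the dimension. *)
Lemma vspace_of_linear_set (F : fieldType) (V : vectType F) (S : set V) :
  S 0 -> (forall u v, S u -> S v -> S (u + v)) ->
  (forall a v, S v -> S (a *: v)) ->
  exists U : {vspace V}, forall v, v \in U <-> S v.
Proof.
move=> S0 SD SZ.
pose P d := `[< exists U : {vspace V}, \dim U = d /\ forall v, v \in U -> S v >].
have exP : exists d, P d.
  exists 0%N; apply/asboolP; exists 0%VS; split; first exact: dimv0.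
  by move=> v; rewrite memv0 => /eqP ->.
have ubP d : P d -> (d <= \dim {:V})%N.
  by move=> /asboolP [U [<- _]]; apply: dimvS; exact: subvf.
case: (ex_maxnP exP ubP) => d /asboolP [U [dU US]] maxd.
exists U => v; split; first exact: US.
move=> Sv; apply: contrapT => /negP vU.
have : P (\dim (U + <[v]>)%VS).
  apply/asboolP; exists (U + <[v]>)%VS; split=> // w /memv_addP[a aU [b /vlineP[c ->] ->]].
  by apply: SD; [exact: US | exact: SZ].
move=> /maxd; rewrite -dU leqNgt => /negP; apply.
rewrite ltn_neqAle dimvS ?addvSl // andbT.
apply: contra vU => /eqP e.
have /eqP -> : U == (U + <[v]>)%VS by rewrite eqEdim addvSl e leqnn.
by apply: (subvP (addvSr U <[v]>)); exact: memv_line.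
Qed.

(** * Domination and faces in a convex cone *)

Section ConeOrder.
Context {R : realType} {n : nat}.
Implicit Types (x y z u v : 'cV[R]_n) (A : 'M[R]_n).

Definition dominates (K : set 'cV[R]_n) x y : Prop :=
  exists2 e : R, 0 < e & K (x - e *: y).

(* For [x] in [K] this is the linear span of the face [Phi K x]. *)
Definition face_span (K : set 'cV[R]_n) x : {vspace 'cV[R]_n} :=
  xget 0%VS [set U : {vspace 'cV[R]_n} |
    forall v, v \in U <-> dominates K x v /\ dominates K x (- v)].

Section ConvexCone.
Variable K : set 'cV[R]_n.
Hypothesis hK : convex_cone K.
Let K0 : K 0. Proof. by case: hK. Qed.
Let KD x y : K x -> K y -> K (x + y). Proof. by case: hK => _ + _; apply. Qed.
Let KZ (a : R) x : 0 <= a -> K x -> K (a *: x).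
Proof. by case: hK => _ _; apply. Qed.

Lemma dominates_sub x y : K (x - y) -> dominates K x y.
Proof. by exists 1; rewrite ?scale1r. Qed.

Lemma dominates_refl x : dominates K x x.
Proof. by apply: dominates_sub; rewrite subrr. Qed.

Lemma dominates_trans y x z : dominates K x y -> dominates K y z -> dominates K x z.
Proof.
move=> [e e0 xy] [f f0 yz]; exists (e * f); first exact: mulr_gt0.
suff -> : x - (e * f) *: z = (x - e *: y) + e *: (y - f *: z).
  by apply: KD => //; apply: KZ => //; exact: ltW.
by rewrite scalerBr scalerA addrA subrK.
Qed.

Lemma dominatesD x y z : dominates K x y -> dominates K x z -> dominates K x (y + z).
Proof.
move=> [e e0 xy] [f f0 xz].
have s0 : 0 < e + f by exact: addr_gt0.
(* This constant makes the difference a convex combination of the two given vectors, with weights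
   [f / (e + f)] and [e / (e + f)]. *)
exists (e * f / (e + f)); first by rewrite divr_gt0 ?mulr_gt0.
suff -> : x - (e * f / (e + f)) *: (y + z)
    = (f / (e + f)) *: (x - e *: y) + (e / (e + f)) *: (x - f *: z).
  by apply: KD; apply: KZ => //; rewrite divr_ge0 // ltW.
apply/matrixP => i j; rewrite !mxE; field; exact: lt0r_neq0.
Qed.

Lemma dominatesZ (a : R) x y : K x -> 0 <= a -> dominates K x y -> dominates K x (a *: y).
Proof.
move=> Kx; rewrite le_eqVlt => /predU1P[<- _|a0 [e e0 xy]].
  by apply: dominates_sub; rewrite scale0r subr0.
exists (e / a); first exact: divr_gt0.
by rewrite scalerA divfK // gt_eqF.
Qed.

Lemma dominates_mulmx A x y : cone_preserving K A ->
  dominates K x y -> dominates K (A *m x) (A *m y).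
Proof. by move=> hA [e e0 /hA xy]; exists e => //; rewrite scalemxAr -mulmxBr. Qed.

Lemma mem_face_span x v : K x ->
  v \in face_span K x <-> dominates K x v /\ dominates K x (- v).
Proof.
move=> Kx; rewrite /face_span; move: v.
(* Two-sided domination is a linear condition, so the default of [xget] is not taken. *)
have [U hU] : exists U : {vspace 'cV[R]_n},
    forall v, v \in U <-> (dominates K x v /\ dominates K x (- v)).
  apply: (@vspace_of_linear_set _ _ [set v | dominates K x v /\ dominates K x (- v)]) => /=.
  - by rewrite oppr0; split; apply: dominates_sub; rewrite subr0.
  - move=> u v [xu xNu] [xv xNv]; rewrite opprD.
    by split; exact: dominatesD.
  - move=> a v [xv xNv]; have [a0|a0] := leP 0 a.
      by rewrite -scalerN; split; exact: dominatesZ.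
    rewrite -scaleNr -[a *: v]opprK -scaleNr -scalerN.
    by split; apply: dominatesZ => //; rewrite oppr_ge0 ltW.
have := @xgetPex _ 0%VS [set U : {vspace 'cV[R]_n} |
  forall v, v \in U <-> dominates K x v /\ dominates K x (- v)].
by apply; exists U.
Qed.

Lemma dominates_face_span x y : K x -> K y -> dominates K x y <-> y \in face_span K x.
Proof.
move=> Kx Ky; rewrite mem_face_span //; split=> [xy|[]//]; split=> //.
by apply: dominates_sub; rewrite opprK; exact: KD.
Qed.

Lemma face_spanS x y : K x -> K y -> dominates K x y ->
  (face_span K y <= face_span K x)%VS.
Proof.
move=> Kx Ky xy; apply/subvP => v /(mem_face_span _ Ky) [yv yNv].
by apply/mem_face_span => //; split; exact: dominates_trans xy _.
Qed.

(** Equal dimensions would make the nested spans equal, putting [x] in the span of the face of [y].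
    This drives every induction on face dimension. *)
Lemma dim_face_span_lt x y : K x -> K y -> dominates K x y -> ~ dominates K y x ->
  (\dim (face_span K y) < \dim (face_span K x))%N.
Proof.
move=> Kx Ky xy yNx; have S := face_spanS Kx Ky xy.
rewrite ltn_neqAle dimvS // andbT; apply/negP => /eqP e; apply: yNx.
apply/dominates_face_span => //.
have /eqP -> : face_span K y == face_span K x by rewrite eqEdim S e leqnn.
by apply/dominates_face_span => //; exact: dominates_refl.
Qed.

Lemma dim_face_span_gt0 x : K x -> x != 0 -> (0 < \dim (face_span K x))%N.
Proof.
move=> Kx x0; rewrite lt0n dimv_eq0; apply: contra x0 => /eqP e.
by rewrite -memv0 -e; apply/dominates_face_span => //; exact: dominates_refl.
Qed.

(** The right-hand set is itself a face; conversely, a face through [x] contains some [e *: y] with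
    [e > 0], hence [y]. *)
Lemma PhiE x : K x -> Phi K x = [set y | K y /\ dominates K x y].
Proof.
move=> Kx; apply/seteqP; split=> [y|y [Ky [e e0 xy]]].
- apply; split=> [|_ ->]; last by split=> //; exact: dominates_refl.
  split=> [|z []//|].
  + split=> [|u v [Ku xu] [Kv xv]|a v a0 [Kv xv]].
    * by split=> //; apply: dominates_sub; rewrite subr0.
    * by split; [exact: KD | exact: dominatesD].
    * by split; [exact: KZ | exact: dominatesZ].
  + move=> u v [Ku xu] Kv uv; split=> //.
    exact: dominates_trans xu (dominates_sub uv).
- move=> F [[[F0 FD FZ] FK FF] xF].
  suff : F (e *: y).
    move=> /(FZ e^-1); rewrite scalerA mulVf ?gt_eqF// scale1r; apply.
    by rewrite invr_ge0 ltW.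
  apply: (FF x) => //; first exact: xF.
  by apply: KZ => //; exact: ltW.
Qed.

Lemma PhiS x y : K x -> K y -> Phi K y `<=` Phi K x <-> dominates K x y.
Proof.
move=> Kx Ky; rewrite !PhiE //; split=> [h|xy z [Kz yz]].
  by have [] : K y /\ dominates K x y by apply: h; split=> //; exact: dominates_refl.
by split=> //; exact: dominates_trans xy yz.
Qed.

Lemma extreme_vectorP x : extreme_vector K x <->
  [/\ K x, x != 0 & forall y, K y -> dominates K x y -> exists2 a : R, 0 <= a & y = a *: x].
Proof.
split=> [[Kx x0]|[Kx x0 h]].
  rewrite PhiE // => e; split=> // y Ky xy.
  have [a /= a0 <-] : [set a *: x | a in [set a : R | 0 <= a]] y by rewrite -e.
  by exists a.
split=> //; rewrite PhiE //; apply/seteqP; split=> [y [Ky xy]|_ [a /= a0 <-]].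
  by have [a a0 ->] := h y Ky xy; exists a.
by split; [exact: KZ | apply: dominatesZ => //; exact: dominates_refl].
Qed.

End ConvexCone.
End ConeOrder.

(** * Proper cones: maximal subtraction, interior and extreme vectors *)

Section ProperCone.
Context {R : realType} {n : nat} {K : set 'cV[R]_n}.
Hypothesis hK : proper_cone K.
Implicit Types (x y z u v : 'cV[R]_n) (A : 'M[R]_n).

Let cK : convex_cone K. Proof. by case: hK. Qed.
Let KD x y : K x -> K y -> K (x + y). Proof. by case: cK => _ + _; apply. Qed.
Let KZ (a : R) x : 0 <= a -> K x -> K (a *: x).
Proof. by case: cK => _ _; apply. Qed.

Lemma proper_cone_pointed x : K x -> K (- x) -> x = 0.
Proof.
case: hK => _ _ pK _ Kx KNx.
have : (K `&` [set - y | y in K]) x by split=> //; exists (- x) => //; rewrite opprK.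
by rewrite pK.
Qed.

Lemma continuous_line x v : continuous (fun t : R => x + t *: v).
Proof.
move=> t; apply: (@continuousD _ _ _ (cst x) (fun t : R => t *: v)).
  exact: cst_continuous.
exact: scalel_continuous.
Qed.

Lemma closed_line x v : closed [set t : R | K (x + t *: v)].
Proof.
have [_ clK _ _] := hK.
by have /continuous_closedP /(_ _ clK) := @continuous_line x v.
Qed.

(** For unbounded [t], the vectors [t^-1 *: x - z] of [K] would tend to [- z], contradicting
    closedness and pointedness. *)
Lemma bounded_subtraction x z : K z -> z != 0 ->
  exists M : R, forall t, K (x - t *: z) -> t <= M.
Proof.
move=> Kz z0; apply: contrapT => unb.
have big (M : R) : exists2 t, M < t & K (x - t *: z).
  apply: contrapT => h; apply: unb; exists M => t Kt.
  by rewrite leNgt; apply/negP => Mt; apply: h; exists t.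
suff KNz : K (- z + 0 *: x).
  by move: z0; rewrite (proper_cone_pointed Kz) ?eqxx //; rewrite scale0r addr0 in KNz.
apply: (@closed_line (- z) x) => B /nbhs_ballP [e /= e0 eB].
have [t et Kt] := big e^-1.
have t0 : 0 < t by apply: lt_trans et; rewrite invr_gt0.
exists t^-1; split.
  rewrite /= addrC (_ : _ - _ = t^-1 *: (x - t *: z)).
    by apply: KZ => //; rewrite invr_ge0 ltW.
  by rewrite scalerBr scalerA mulVf ?gt_eqF// scale1r.
apply: eB; rewrite /ball /= sub0r normrN gtr0_norm ?invr_gt0//.
by rewrite invf_plt ?posrE.
Qed.

(** The supremum of the admissible [t] is attained because [K] is closed, and nothing more of [z]
    can then be removed. *)
Lemma maximal_subtraction x z : K x -> K z -> z != 0 ->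
  exists t : R, [/\ 0 <= t, K (x - t *: z) & ~ dominates K (x - t *: z) z].
Proof.
move=> Kx Kz z0.
have [M hM] := bounded_subtraction x Kz z0.
pose S := [set t : R | K (x + t *: - z)].
have hub : has_ubound S by exists M => t; rewrite /S /= scalerN; exact: hM.
have S0 : S 0 by rewrite /S /= scale0r addr0.
have KS : S (sup S).
  by apply: closed_line; apply: closure_sup => //; exists 0.
exists (sup S); split.
- exact: ub_le_sup.
- by move: KS; rewrite /S /= scalerN.
- move=> [e e0]; rewrite -addrA -opprD -scalerDl => KSe.
  have : sup S + e <= sup S by apply: ub_le_sup => //; rewrite /S /= scalerN.
  by rewrite gerDl leNgt e0.
Qed.

Lemma interior_dominates x v : K° x -> dominates K x v.
Proof.
move=> Kx.
have : nbhs (0 : R) [set t | K (x + t *: - v)].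
  by apply: (@continuous_line x (- v) 0); rewrite /= scale0r addr0.
move=> /nbhs_ballP [e /= e0 eB]; exists (e / 2); first exact: divr_gt0.
have := eB (e / 2); rewrite /= scalerN; apply.
rewrite /ball /= sub0r normrN gtr0_norm ?divr_gt0//.
by rewrite ltr_pdivrMr// ltr_pMr// ltr1n.
Qed.

(** Since [x = y + e *: u] with [y] in [K], scaling by [e] and translating by [y] carries a
    neighbourhood of [u] in [K] to one of [x] in [K]. *)
Lemma dominates_interior u x : K° u -> dominates K x u -> K° x.
Proof.
move=> Ku [e e0 Ky]; set y := x - e *: u in Ky.
have cont : continuous (fun w : 'cV[R]_n => e^-1 *: (w - y)).
  move=> w; apply: (@cvgZl_tmp _ _ _ (nbhs w) _ e^-1 (fun w => w - y) (w - y)).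
  by apply: (@cvgB _ _ _ (nbhs w) _ id (cst y) w y); [exact: cvg_id | exact: cvg_cst].
have : nbhs x [set w | K (e^-1 *: (w - y))].
  apply: cont; suff -> : e^-1 *: (x - y) = u by [].
  by rewrite /y opprB addrCA subrr addr0 scalerA mulVf ?gt_eqF// scale1r.
apply: filterS => w /= Kw.
have -> : w = y + e *: (e^-1 *: (w - y)).
  by rewrite scalerA mulfV ?gt_eqF// scale1r addrC subrK.
by apply: KD => //; apply: KZ => //; exact: ltW.
Qed.

(* Subtracting as much as possible of a non-proportional face element shrinks
   the face, so a dominated vector of minimal face dimension is extreme. *)
Lemma dominates_extreme x : K x -> x != 0 ->
  exists2 y, extreme_vector K y & dominates K x y.
Proof.
have [d] := ubnP (\dim (face_span K x)).
elim: d x => // d IH x; rewrite ltnS => dx Kx x0.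
have [ex|] := pselect (extreme_vector K x).
  by exists x => //; exact: dominates_refl.
move=> nex.
have [z [Kz xz nz]] : exists z, [/\ K z, dominates K x z &
    forall a : R, 0 <= a -> z <> a *: x].
  apply: contrapT => h; apply: nex; apply/extreme_vectorP => //.
  split=> // y Ky xy; apply: contrapT => h'; apply: h; exists y; split=> // a a0 e.
  by apply: h'; exists a.
have z0 : z != 0 by apply/eqP => e; apply: (nz 0) => //; rewrite scale0r.
have [t [t0 Ky yz]] := maximal_subtraction Kx Kz z0.
set y := x - t *: z in Ky yz.
have xy : dominates K x y.
  by apply: (dominates_sub); rewrite /y subKr; exact: KZ.
have y0 : y != 0.
  rewrite /y subr_eq0; apply/eqP => e.
  have t1 : 0 < t.
    rewrite lt_neqAle t0 andbT; apply: contra x0 => /eqP t00.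
    by rewrite e -t00 scale0r.
  apply: (nz t^-1); first by rewrite invr_ge0.
  by rewrite e scalerA mulVf ?gt_eqF// scale1r.
have lt : (\dim (face_span K y) < \dim (face_span K x))%N.
  apply: dim_face_span_lt => // yx; apply: yz.
  exact: (dominates_trans cK yx xz).
have [w ew yw] := IH y (leq_trans lt dx) Ky y0.
exists w => //; exact: (dominates_trans cK xy yw).
Qed.

(** An interior [x] dominates every vector; if it were also extreme, the whole space would be the
    line through [x]. *)
Lemma extreme_not_interior x : (1 < n)%N -> extreme_vector K x -> ~ K° x.
Proof.
move=> n1 /(extreme_vectorP cK) [Kx x0 ex] ix.
suff : (\dim {: 'cV[R]_n} <= 1)%N.
  by rewrite dimvf dim_matrix mulr1 leqNgt n1.
apply: leq_trans (_ : \dim <[x]> <= 1)%N; last by rewrite dim_vline; case: eqP.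
apply: dimvS; apply/subvP => v _.
have [e e0 Kv] := interior_dominates v ix.
have [a _ ea] := ex _ Kv (interior_dominates _ ix).
apply/vlineP; exists (e^-1 * (1 - a)).
rewrite -scalerA scalerBl scale1r -ea subKr scalerA mulVf ?gt_eqF//.
by rewrite scale1r.
Qed.

(** Subtract as much of [y] as possible: a nonzero remainder would dominate an extreme vector,
    necessarily a multiple of [y], against maximality. *)
Lemma dominates_unique_extreme x y : K x -> extreme_vector K y -> dominates K x y ->
  (forall z, extreme_vector K z -> dominates K x z -> dominates K y z) ->
  exists2 a : R, 0 < a & x = a *: y.
Proof.
move=> Kx exy xy uy.
have /(extreme_vectorP cK) [Ky y0 _] := exy.
have [t [t0 Kw wy]] := maximal_subtraction Kx Ky y0.
set w := x - t *: y in Kw wy.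
have xw : dominates K x w by apply: dominates_sub; rewrite /w subKr; exact: KZ.
have w0 : w = 0.
  apply: contrapT => /eqP w0.
  have [z exz wz] := dominates_extreme Kw w0.
  have yz := uy _ exz (dominates_trans cK xw wz).
  have /(extreme_vectorP cK) [Kz z0 _] := exz.
  have /(extreme_vectorP cK) [_ _ /(_ z Kz yz) [a a0 e]] := exy.
  apply: wy; have a1 : 0 < a.
    rewrite lt_neqAle a0 andbT; apply: contra z0 => /eqP a00.
    by rewrite e -a00 scale0r.
  suff -> : y = a^-1 *: z by apply: dominatesZ => //; rewrite invr_ge0.
  by rewrite e scalerA mulVf ?gt_eqF// scale1r.
have ex : x = t *: y by apply/eqP; rewrite -subr_eq0 -/w w0.
exists t => //; rewrite lt_neqAle t0 andbT; apply/negP => /eqP t00.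
case: xy => e e0; rewrite ex -t00 scale0r sub0r => KNy.
move: y0; rewrite (proper_cone_pointed Ky) ?eqxx//.
have := KZ (ltW (_ : 0 < e^-1)) KNy.
by rewrite scalerN scalerA mulVf ?gt_eqF// scale1r; apply; rewrite invr_gt0.
Qed.

End ProperCone.

(** * Strictly positive functionals and existence of a primitive matrix *)

Lemma uniform_scaling (R : realFieldType) (T : eqType) (s : seq T) (F G : T -> R) :
  (forall v, v \in s -> 0 < F v) ->
  exists M : R, forall v, v \in s -> 0 < M * F v + G v.
Proof.
elim: s => [_|w s IH Fs]; first by exists 0.
have [v vs|M hM] := IH; first by apply: Fs; rewrite inE vs orbT.
have Fw : 0 < F w by apply: Fs; rewrite mem_head.
(* The second entry gives the expression the value 1 at [w]. *)
exists (Num.max M ((1 - G w) / F w)) => v; rewrite inE => /predU1P [->|vs].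
  apply: (@lt_le_trans _ _ ((1 - G w) / F w * F w + G w)).
    by rewrite divfK ?gt_eqF// subrK.
  by rewrite lerD2r ler_pM2r// le_max lexx orbT.
apply: lt_le_trans (hM v vs) _.
by rewrite lerD2r ler_pM2r ?le_max ?lexx// Fs// inE vs orbT.
Qed.

Section PositiveFunctional.
Context {R : realType} {n : nat} {K : set 'cV[R]_n}.
Hypothesis hK : proper_cone K.
Implicit Types (x y z u v : 'cV[R]_n) (A : 'M[R]_n).

Let cK : convex_cone K. Proof. by case: hK. Qed.
Let KD x y : K x -> K y -> K (x + y). Proof. by case: cK => _ + _; apply. Qed.
Let KZ (a : R) x : 0 <= a -> K x -> K (a *: x).
Proof. by case: cK => _ _; apply. Qed.

(* Fourier-Motzkin elimination: if the functional [f] positive on the tail is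
   negative at the head [e], project the tail along [e] into the kernel of [f]. *)
Lemma positive_functional_seq (s : seq 'cV[R]_n) :
  (forall v, v \in s -> K v /\ v != 0) ->
  exists f : 'rV[R]_n, forall v, v \in s -> 0 < (f *m v) 0 0.
Proof.
have [d] := ubnP (size s).
elim: d s => // d IH [_ _|e s /= sd hs]; first by exists 0.
have hs' v : v \in s -> K v /\ v != 0 by move=> vs; apply: hs; rewrite inE vs orbT.
have [Ke e0] := hs e (mem_head _ _).
have [f hf] := IH s sd hs'.
have [fe|fe|fe] := ltgtP ((f *m e) 0 0) 0; last first.
(* When [f] vanishes at [e], add [e^T], whose value at [e] is a positive sum of squares; a large
   multiple of [f] keeps the tail positive. *)
- have [M hM] := @uniform_scaling _ _ s (fun v => (f *m v) 0 0)
    (fun v => (e^T *m v) 0 0) hf.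
  exists (M *: f + e^T) => v; rewrite mulmxDl -scalemxAl !mxE.
  have eE : forall g : 'rV[R]_n, \sum_j g 0 j * v j 0 = (g *m v) 0 0 by move=> g; rewrite mxE.
  rewrite !eE inE => /predU1P [->|/hM//].
  rewrite fe mulr0 add0r mxE.
  have pos j : 0 <= e^T 0 j * e j 0 by rewrite mxE -expr2 sqr_ge0.
  rewrite lt_neqAle sumr_ge0 ?andbT; last by move=> j _; exact: pos.
  rewrite eq_sym psumr_eq0; last by move=> j _; exact: pos.
  apply: contra e0 => /allP z0; apply/eqP/matrixP => i j.
  have := z0 i; rewrite mem_index_enum mxE => /(_ isT) /=.
  by rewrite -expr2 sqrf_eq0 ord1 => /eqP ->; rewrite mxE.
- by exists f => v; rewrite inE => /predU1P [->|/hf].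
pose c v := (f *m v) 0 0 / (f *m e) 0 0.
have c0 v : v \in s -> 0 < - c v.
  by move=> /hf fv; rewrite oppr_gt0 /c pmulr_rlt0// invr_lt0.
have [||g hg] := IH [seq v - c v *: e | v <- s].
- by rewrite size_map.
- move=> _ /mapP [v vs ->]; have [Kv v0] := hs' v vs.
  have KNc : K (- (c v *: e)) by rewrite -scaleNr; apply: KZ => //; rewrite ltW// c0.
  split; first exact: KD.
  rewrite subr_eq0; apply: contra v0 => /eqP ev.
  by apply/eqP; apply: (proper_cone_pointed hK) => //; rewrite ev.
have [M hM] := @uniform_scaling _ _ s (fun v => (g *m (v - c v *: e)) 0 0)
  c (fun v vs => hg _ (map_f (fun v => v - c v *: e) vs)).
(* With this [t] the new functional is 1 at [e], and at [v] it is [M] times the value of [g] at the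
   projected vector, plus [c v]. *)
pose t := (1 - M * (g *m e) 0 0) / (f *m e) 0 0.
have hE v : ((M *: g + t *: f) *m v) 0 0 = M * (g *m v) 0 0 + t * (f *m v) 0 0.
  by rewrite mulmxDl -!scalemxAl mxE [in LHS]mxE [X in _ + X]mxE.
exists (M *: g + t *: f) => v; rewrite inE hE => /predU1P [->|vs].
  by rewrite /t divfK ?lt_eqF// addrC subrK.
have := hM v vs; rewrite mulmxBr -scalemxAr.
have -> : (g *m v - c v *: (g *m e)) 0 0 = (g *m v) 0 0 - c v * (g *m e) 0 0.
  by rewrite mxE [X in _ + X]mxE [in X in - X]mxE.
suff -> : M * ((g *m v) 0 0 - c v * (g *m e) 0 0) + c v
   = M * (g *m v) 0 0 + t * (f *m v) 0 0 by [].
by rewrite /t /c; field; rewrite lt_eqF.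
Qed.

(** Positivity spreads from [s] to [K] by induction on face dimension: subtracting a maximal
    multiple of a dominated [v] in [s] leaves 0 or a vector with a smaller face. *)
Lemma positive_functional (s : seq 'cV[R]_n) :
  (forall v, v \in s -> extreme_vector K v) ->
  (forall x, extreme_vector K x -> exists2 v, v \in s & dominates K x v) ->
  exists f : 'rV[R]_n, forall x, K x -> x != 0 -> 0 < (f *m x) 0 0.
Proof.
move=> sext sall.
have sK v : v \in s -> K v /\ v != 0.
  by move=> /sext /(extreme_vectorP cK) [].
have [f hf] := positive_functional_seq sK.
exists f => x; have [d] := ubnP (\dim (face_span K x)).
elim: d x => // d IH x; rewrite ltnS => dx Kx x0.
have [y exy xy] := dominates_extreme hK Kx x0.
have [v vs yv] := sall y exy; have [Kv v0] := sK v vs.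
have xv := dominates_trans cK xy yv.
have [t [t0 Kw wv]] := maximal_subtraction hK Kx Kv v0.
have fx : (f *m x) 0 0 = (f *m (x - t *: v)) 0 0 + t * (f *m v) 0 0.
  rewrite mulmxBr -scalemxAr [in RHS]mxE [X in _ = _ + X + _]mxE.
  by rewrite [X in _ = _ - X + _]mxE subrK.
have tfv : 0 <= t * (f *m v) 0 0 by rewrite mulr_ge0// ltW// hf.
have [w0|w0] := eqVneq (x - t *: v) 0.
  rewrite fx w0 mulmx0 mxE add0r mulr_gt0 ?hf// lt_neqAle t0 andbT.
  apply: contra x0 => /eqP e; move/eqP: w0.
  by rewrite -e scale0r subr0.
rewrite fx; apply: ltr_wpDr => //; apply: IH => //.
apply: leq_trans dx; apply: dim_face_span_lt => //.
  by apply: dominates_sub; rewrite subKr; exact: KZ.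
by move=> wx; apply: wv; exact: (dominates_trans cK wx xv).
Qed.

Lemma rank_one_K_primitive u (f : 'rV[R]_n) : K° u ->
  (forall x, K x -> x != 0 -> 0 < (f *m x) 0 0) -> K_primitive K (u *m f).
Proof.
move=> iu fpos; have Ku := interior_subset iu.
have E x : u *m f *m x = (f *m x) 0 0 *: u.
  by rewrite -mulmxA [f *m x]mx11_scalar mul_mx_scalar !mxE.
split.
  move=> x Kx; rewrite E; apply: KZ => //.
  by have [->|x0] := eqVneq x 0; [rewrite mulmx0 mxE | exact: ltW (fpos x Kx x0)].
exists 1%N; split=> // x Kx x0; rewrite expr1 E.
apply: (dominates_interior hK iu); exists ((f *m x) 0 0); first exact: fpos.
by rewrite subrr; case: cK.
Qed.

End PositiveFunctional.

(** * Combinatorics: digraphs whose selections all trace long lassos *)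

Section WielandtDigraph.
Variables (T : finType) (arc : rel T) (x0 : T) (m : nat).
Hypotheses (cardT : #|T| = m) (m3 : (2 < m)%N).

Definition arc_selection (t : T -> T) := forall x, arc x (t x).

(** [orbit_inj] and [orbit_loop] say that every selection traces a lasso through all vertices with
    tail at most 1; [branching] provides a second out-arc at some vertex reached after at least one
    step. *)
Hypothesis out_arc : forall x, exists y, arc x y.
Hypothesis orbit_inj : forall t, arc_selection t ->
  forall i j, (i < m)%N -> (j < m)%N -> iter i t x0 = iter j t x0 -> i = j.
Hypothesis orbit_loop : forall t, arc_selection t ->
  iter m t x0 = x0 \/ iter m t x0 = t x0.
Hypothesis branching : forall t, arc_selection t ->
  exists q y, [/\ (0 < q)%N, arc (iter q t x0) y & y != iter q.+1 t x0].

Lemma orbit_surj t y : arc_selection t -> exists2 i, (i < m)%N & y = iter i t x0.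
Proof.
move=> ht; pose f (i : 'I_m) := iter i t x0.
have f_inj : injective f.
  by move=> i j /(orbit_inj ht (ltn_ord i) (ltn_ord j)) /val_inj.
have /codomP [i ->] : y \in codom f by apply: inj_card_onto; rewrite ?card_ord ?cardT.
by exists (i : nat).
Qed.

Definition redirect (t : T -> T) c d := fun x => if x == c then d else t x.

Lemma redirect_selection t c d : arc_selection t -> arc c d ->
  arc_selection (redirect t c d).
Proof. by move=> ht cd x; rewrite /redirect; case: eqP => [->|_]. Qed.

Lemma iter_redirect t k d j : arc_selection t -> (k < m)%N -> (j <= k)%N ->
  iter j (redirect t (iter k t x0) d) x0 = iter j t x0.
Proof.
move=> ht km; elim: j => // j IH jk; rewrite iterS IH ?(ltnW jk)// /redirect.
case: eqP => // /(orbit_inj ht (ltn_trans jk km) km) e.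
by rewrite e ltnn in jk.
Qed.

Lemma iter_redirectS t k d : arc_selection t -> (k < m)%N ->
  iter k.+1 (redirect t (iter k t x0) d) x0 = d.
Proof. by move=> ht km; rewrite iterS iter_redirect// /redirect eqxx. Qed.

(** After the jump the new orbit follows the old one, which avoids position [k] from [l] up to
    [m.-1]; step [m] itself is therefore still covered. *)
Lemma iter_redirect_forward t k l r : arc_selection t -> (k < l)%N -> (l < m)%N ->
  (l + r <= m)%N ->
  iter (k.+1 + r) (redirect t (iter k t x0) (iter l t x0)) x0 = iter (l + r) t x0.
Proof.
move=> ht kl lm; have km := ltn_trans kl lm.
elim: r => [_|r IH]; first by rewrite !addn0 iter_redirectS.
rewrite !addnS => lr; rewrite iterS IH ?(ltnW lr)// /redirect.
case: eqP => // /(orbit_inj ht lr km) e.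
by move: kl; rewrite -e ltnNge leq_addr.
Qed.

(** Redirecting the last vertex along the arc puts the new orbit at its target at step [m], where
    [orbit_loop] leaves two possibilities. *)
Lemma arc_last t l : arc_selection t -> (l < m)%N ->
  arc (iter m.-1 t x0) (iter l t x0) -> l = 0%N \/ l = 1%N.
Proof.
move=> ht lm al; have m1 : (m.-1 < m)%N by lia.
have ht' := redirect_selection ht al.
have := iter_redirectS (iter l t x0) ht m1; rewrite prednK; last by lia.
have /= i1 := @iter_redirect t m.-1 (iter l t x0) 1 ht m1 ltac:(lia).
case: (orbit_loop ht') => ->; rewrite ?i1 => e; [left | right];
  apply: (orbit_inj ht) => //; lia.
Qed.

(* Redirecting the orbit along a shortcut [l > k.+1] would make it close up
   before step [m]. The shortcut from [x0] itself escapes this argument when the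
   orbit returns to [t x0] rather than to [x0], hence the last hypothesis. *)
Lemma arc_inner t k l : arc_selection t -> (k.+1 < m)%N -> (l < m)%N ->
  (0 < k)%N \/ iter m t x0 = x0 ->
  arc (iter k t x0) (iter l t x0) -> l = k.+1.
Proof.
move=> ht km lm hk al; have ht' := redirect_selection ht al.
have km' := ltnW km; case: (ltngtP l k.+1) => // hl; exfalso.
  (* A backward arc makes the redirected orbit repeat a vertex at step [k.+1], before step [m]. *)
  have e1 := iter_redirectS (iter l t x0) ht km'.
  have e2 := iter_redirect (iter l t x0) ht km' hl.
  have := orbit_inj ht' km lm (etrans e1 (esym e2)); lia.
(* For a shortcut, [m - l] further steps reach [iter m t x0], a vertex already visited at step 0 or
   1, too early. *)
have := @iter_redirect_forward t k l (m - l) ht ltac:(lia) lm ltac:(lia).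
have -> : (l + (m - l) = m)%N by lia.
have il : (k.+1 + (m - l) < m)%N by lia.
case: (orbit_loop ht) hk => em hk.
  by rewrite em => e; have := @orbit_inj _ ht' _ 0%N il ltac:(lia) e; lia.
case: hk => [k0|e0].
  have e1 := iter_redirect (iter l t x0) ht km' k0.
  rewrite em => e; have := @orbit_inj _ ht' _ 1%N il ltac:(lia) (etrans e (esym e1)); lia.
by rewrite e0 => e; have := @orbit_inj _ ht' _ 0%N il ltac:(lia) e; lia.
Qed.

(** If the orbit returns to [t x0], the branching vertex must be the last one, and its second arc
    must go to [x0]; redirecting along it closes a circuit through all vertices. *)
Lemma exists_full_orbit : exists2 t, arc_selection t & iter m t x0 = x0.
Proof.
pose t x := xchoose (out_arc x).
have ht : arc_selection t by move=> x; exact: xchooseP.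
case: (orbit_loop ht) => e; first by exists t.
have [q [y [q0 aq yq]]] := branching ht.
(* Positions 1 to [m.-1] form a circuit here, so [q] can be reduced to that range. *)
have [k [k0 km qk]] : exists k, [/\ (0 < k)%N, (k < m)%N & iter q t x0 = iter k t x0].
  elim: q q0 {aq yq} => // q IH _; have [->|q0] := posnP q; first by exists 1%N; split=> //; lia.
  have [k [k0 km qk]] := IH q0; have [km'|km'] := ltnP k.+1 m.
    by exists k.+1; rewrite !iterS qk.
  exists 1%N; split=> //; first by lia.
  by rewrite iterS qk -iterS (_ : k.+1 = m) //; lia.
rewrite iterS qk -iterS in aq yq *.
have [l lm yl] := orbit_surj y ht; rewrite yl in aq yq.
have [km'|km'] := ltnP k.+1 m.
  by move: yq; rewrite (arc_inner ht km' lm (or_introl k0) aq) eqxx.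
have km1 : k = m.-1 by lia.
have := aq; rewrite km1 => am.
have [l0|l1] := arc_last ht lm am; last first.
  by move: yq; rewrite l1 (_ : k.+1 = m) ?e ?eqxx//; lia.
rewrite l0 /= in am; exists (redirect t (iter m.-1 t x0) x0).
  exact: redirect_selection.
by have := @iter_redirectS t m.-1 x0 ht ltac:(lia); rewrite prednK //; lia.
Qed.

(** Number the vertices along a full circuit. Inner and last vertices admit only the arcs of [F1],
    and branching can be realised only by the arc from the last vertex to position 1. *)
Lemma wielandt_digraph : exists v : nat -> T,
  [/\ v 0%N = x0,
      forall i j, (i < m)%N -> (j < m)%N -> v i = v j -> i = j,
      forall y, exists2 i, (i < m)%N & y = v i &
      forall i j, (i < m)%N -> (j < m)%N -> arc (v i) (v j) <->
        [\/ j = i.+1, i.+1 = m /\ j = 0%N | i.+1 = m /\ j = 1%N]].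
Proof.
have [t ht em] := exists_full_orbit.
exists (fun i => iter i t x0); split=> [//|i j im jm|y|i j im jm].
- exact: orbit_inj.
- exact: orbit_surj.
have arcE k l : (k < m)%N -> (l < m)%N -> arc (iter k t x0) (iter l t x0) ->
    [\/ l = k.+1, k.+1 = m /\ l = 0%N | k.+1 = m /\ l = 1%N].
  move=> km lm a; have [km'|km'] := ltnP k.+1 m.
    by apply: Or31; apply: (arc_inner ht km' lm _ a); right.
  have km1 : k.+1 = m by lia.
  move: a; rewrite (_ : k = m.-1); last by lia.
  by move=> /(arc_last ht lm) [->|->]; [apply: Or32 | apply: Or33]; split=> //; lia.
split; first exact: arcE.
case=> [->|[im1 ->]|[im1 ->]]; first by rewrite iterS; exact: ht.
  by rewrite /= -[x0 in X in arc _ X]em -im1 iterS; exact: ht.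
have [q [y [_ aq yq]]] := branching ht.
have [k km qk] := orbit_surj (iter q t x0) ht.
have [l lm yl] := orbit_surj y ht.
rewrite iterS qk -iterS yl in aq yq.
case: (arcE k l km lm aq) => [lk|[km1 l0]|[km1 l1]].
- by rewrite lk eqxx in yq.
- by rewrite l0 km1 em eqxx in yq.
- by move: aq; rewrite l1 (_ : k = i) //; lia.
Qed.

End WielandtDigraph.

(** * Primitive matrices: time needed to reach the interior *)

Section Primitive.
Context {R : realType} {n : nat} {K : set 'cV[R]_n}.
Hypothesis hK : proper_cone K.
Implicit Types (x y z u v : 'cV[R]_n) (A B : 'M[R]_n).

Let cK : convex_cone K. Proof. by case: hK. Qed.
Let KZ (a : R) x : 0 <= a -> K x -> K (a *: x).
Proof. by case: cK => _ _; apply. Qed.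

Lemma expmxS A p x : A ^+ p.+1 *m x = A *m (A ^+ p *m x).
Proof. by rewrite exprS -mulmxE mulmxA. Qed.

Lemma expmxSr A p x : A ^+ p.+1 *m x = A ^+ p *m (A *m x).
Proof. by rewrite exprSr -mulmxE mulmxA. Qed.

Lemma expmxD A p q x : A ^+ (p + q) *m x = A ^+ p *m (A ^+ q *m x).
Proof. by rewrite exprD -mulmxE mulmxA. Qed.

Lemma cone_preservingX A p : cone_preserving K A -> cone_preserving K (A ^+ p).
Proof.
move=> hA x Kx; elim: p => [|p IH]; first by rewrite expr0 mul1mx.
by rewrite expmxS; exact: hA.
Qed.

(* The faces of [x], [B x], [B^2 x], ... increase, hence strictly until they
   reach [K], and their dimensions are between 1 and [n]. *)
Lemma interior_of_increasing_orbit B x N : (0 < n)%N -> cone_preserving K B ->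
  K x -> x != 0 -> K° (B ^+ N *m x) -> dominates K (B *m x) x ->
  K° (B ^+ n.-1 *m x).
Proof.
move=> n0 hB Kx x0 iN hx.
have KB j : K (B ^+ j *m x) by exact: cone_preservingX.
have step j : dominates K (B ^+ j.+1 *m x) (B ^+ j *m x).
  by rewrite expmxSr; apply: dominates_mulmx => //; exact: cone_preservingX.
have incr j : dominates K (B ^+ j *m x) x.
  elim: j => [|j IH]; first by rewrite expr0 mul1mx; exact: dominates_refl.
  exact: (dominates_trans cK (step j) IH).
(* Once one step adds nothing to the face, no later step does, so the face already contains the
   interior vector [B ^+ N *m x]. *)
have stable j : dominates K (B ^+ j *m x) (B ^+ j.+1 *m x) -> K° (B ^+ j *m x).
  move=> hj; apply: (dominates_interior hK iN).
  elim: N {iN} => [|l IH]; first by rewrite expr0 mul1mx; exact: incr.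
  apply: (dominates_trans cK hj); rewrite !expmxS.
  exact: dominates_mulmx.
have main j : K° (B ^+ j *m x) \/ (j < \dim (face_span K (B ^+ j *m x)))%N.
  elim: j => [|j [ij|dj]].
  - by right; rewrite expr0 mul1mx; exact: dim_face_span_gt0.
  - by left; exact: (dominates_interior hK ij (step j)).
  have [/stable ij|nj] := pselect (dominates K (B ^+ j *m x) (B ^+ j.+1 *m x)).
    by left; exact: (dominates_interior hK ij (step j)).
  by right; apply: leq_ltn_trans dj _; exact: dim_face_span_lt.
have [//|] := main n.-1; rewrite prednK// => dn.
have [_ _ _ [u iu]] := hK; have Ku := interior_subset iu.
apply: (dominates_interior hK iu); apply/dominates_face_span => //.
suff /eqP -> : face_span K (B ^+ n.-1 *m x) == {:'cV[R]_n}%VS by exact: memvf.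
by rewrite eqEdim subvf dimvf dim_matrix mulr1.
Qed.

Variable A : 'M[R]_n.
Hypothesis primA : K_primitive K A.

Let hA : cone_preserving K A. Proof. by case: primA. Qed.

Lemma K_primitive_mulmx_neq0 x : K x -> x != 0 -> A *m x != 0.
Proof.
move=> Kx x0; apply: contra (x0) => /eqP Ax0.
have [_ [p [p0 /(_ x Kx x0)]]] := primA.
rewrite -(prednK p0) expmxSr Ax0 mulmx0 => /(interior_dominates x) [e e0].
rewrite sub0r => KNx; apply/eqP; apply: (proper_cone_pointed hK Kx).
have := KZ (ltW (_ : 0 < e^-1)) KNx.
by rewrite scalerN scalerA mulVf ?gt_eqF// scale1r; apply; rewrite invr_gt0.
Qed.

Lemma K_primitive_expmx_neq0 p x : K x -> x != 0 -> A ^+ p *m x != 0.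
Proof.
move=> Kx x0; elim: p => [|p IH]; first by rewrite expr0 mul1mx.
rewrite expmxS; apply: K_primitive_mulmx_neq0 => //; exact: cone_preservingX.
Qed.

(** An interior [x] dominates [A ^+ p.-1 *m x], so [A *m x] dominates the interior vector
    [A ^+ p *m x]. *)
Lemma interior_mulmx x : x != 0 -> K° x -> K° (A *m x).
Proof.
move=> x0 ix; have Kx := interior_subset ix.
have [_ [p [p0 /(_ x Kx x0) ip]]] := primA.
apply: (dominates_interior hK ip); rewrite -(prednK p0) expmxS.
by apply: dominates_mulmx => //; exact: interior_dominates.
Qed.

Lemma interior_expmx_leq p q x : (p <= q)%N -> K x -> x != 0 ->
  K° (A ^+ p *m x) -> K° (A ^+ q *m x).
Proof.
move=> /subnKC <- Kx x0 ip; elim: (q - p)%N => [|r IH]; first by rewrite addn0.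
by rewrite addnS expmxS; apply: interior_mulmx => //; exact: K_primitive_expmx_neq0.
Qed.

Lemma lasso_interior x y a s : (0 < n)%N -> (0 < s)%N -> K x -> K y -> y != 0 ->
  dominates K (A ^+ a *m x) y -> dominates K (A ^+ s *m y) y ->
  K° (A ^+ (a + s * n.-1) *m x).
Proof.
move=> n0 s0 Kx Ky y0 xy yy.
have [_ [p [p0 /(_ y Ky y0) ip]]] := primA.
suff iy : K° (A ^+ (s * n.-1) *m y).
  apply: (dominates_interior hK iy); rewrite addnC expmxD.
  by apply: dominates_mulmx => //; exact: cone_preservingX.
rewrite exprM; apply: (@interior_of_increasing_orbit _ _ p) => //.
  exact: cone_preservingX.
rewrite -exprM; apply: interior_expmx_leq ip => //; exact: leq_pmull.
Qed.

End Primitive.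

(** With [s = o - a] at most m - 2, the length is at most m + (m - 2)(n - 2), which is at most (n -
    1)(m - 1) as [n] is at least 3. Hence [s] is m - 1 or m, and m - 1 requires [a > 0]. *)
Lemma lasso_length n m a o : (3 <= n)%N -> (a < o)%N -> (o <= m)%N ->
  (n.-1 * m.-1 < a + (o - a) * n.-1)%N -> o = m /\ (a <= 1)%N.
Proof.
move=> n3 ao om; have [s oE] : exists s, o = (a + s)%N by exists (o - a)%N; lia.
subst o; rewrite addKn => h; have sm : (m.-1 <= s)%N.
  rewrite leqNgt; apply/negP => sm.
  have [p mE] : exists p, m = (s + p).+2 by exists (m - s).-2; lia.
  have [q nE] : exists q, n = q.+3 by exists (n - 3)%N; lia.
  subst m n; move: h om; rewrite /=; nia.
have [se|se] : s = m.-1 \/ s = m by lia.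
  have a0 : (0 < a)%N by rewrite lt0n; apply/eqP => a0; move: h; rewrite se a0; lia.
  lia.
lia.
Qed.

(** * The digraph of extreme rays *)

Section ExtremeRays.
Context {R : realType} {n m : nat} {K : set 'cV[R]_n}.
Hypothesis hK : proper_cone K.
Implicit Types (x y z u v : 'cV[R]_n).

Let cK : convex_cone K. Proof. by case: hK. Qed.

(** One vector is fixed on each extreme ray, so that ['I_m] serves as vertex set. *)
Definition ray_representatives (e : 'I_m -> 'cV[R]_n) : Prop :=
  [/\ forall i, extreme_vector K (e i),
      forall i j, dominates K (e i) (e j) -> i = j &
      forall x, extreme_vector K x -> exists2 i, dominates K x (e i) & dominates K (e i) x].

Lemma extreme_dominates_sym x y : extreme_vector K x -> extreme_vector K y ->
  dominates K x y -> dominates K y x.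
Proof.
move=> /(extreme_vectorP cK) [Kx x0 ex] /(extreme_vectorP cK) [Ky y0 _] xy.
have [a a0 ya] := ex y Ky xy.
have a1 : 0 < a.
  rewrite lt_neqAle a0 andbT; apply: contra y0 => /eqP a00.
  by rewrite ya -a00 scale0r.
have -> : x = a^-1 *: y by rewrite ya scalerA mulVf ?gt_eqF// scale1r.
by apply: dominatesZ => //; [rewrite invr_ge0 ltW | exact: dominates_refl].
Qed.

Lemma extreme_Phi_eq x y : extreme_vector K x -> extreme_vector K y ->
  Phi K x = Phi K y <-> dominates K x y.
Proof.
move=> ex ey; have [Kx _ _] := ex; have [Ky _ _] := ey.
split=> [e|xy]; first by apply/(PhiS cK Kx Ky); rewrite e.
have yx := extreme_dominates_sym ex ey xy.
by apply/seteqP; split; [apply/(PhiS cK Ky Kx) | apply/(PhiS cK Kx Ky)].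
Qed.

Lemma exists_ray_representatives : (extreme_rays K #= `I_m)%card ->
  exists e, ray_representatives e.
Proof.
rewrite card_eq_sym => /card_set_bijP [f [fE finj fsurj]].
have /choice [e he] (i : 'I_m) : exists x, extreme_vector K x /\ Phi K x = f i.
  by have [x ex xf] := fE i (ltn_ord i); exists x.
exists e; split=> [i|i j|x ex]; first by have [] := he i.
- have [ei fi] := he i; have [ej fj] := he j.
  move=> /(extreme_Phi_eq ei ej); rewrite fi fj => fij.
  by apply: val_inj; apply: finj => //; rewrite inE /=; exact: ltn_ord.
- have [i /= im fi] := fsurj (Phi K x) (imageP _ ex).
  have [ei fi'] := he (Ordinal im).
  have xi : dominates K x (e (Ordinal im)) by apply/extreme_Phi_eq => //; rewrite fi'.
  by exists (Ordinal im) => //; exact: extreme_dominates_sym xi.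
Qed.

Variable e : 'I_m -> 'cV[R]_n.
Hypothesis he : ray_representatives e.

Let ext i : extreme_vector K (e i). Proof. by case: he. Qed.
Let Ke i : K (e i). Proof. by have [] := ext i. Qed.
Let e0 i : e i != 0. Proof. by have [] := ext i. Qed.

Lemma dominates_representative x : K x -> x != 0 -> exists i, dominates K x (e i).
Proof.
move=> Kx x0; have [y ey xy] := dominates_extreme hK Kx x0.
have [_ _ /(_ y ey) [i yi _]] := he.
by exists i; exact: (dominates_trans cK xy yi).
Qed.

(** A rank-one matrix [u *m f] with [u] interior and [f] positive sends every nonzero vector of [K]
    to a positive multiple of [u]. This makes [exponents K] nonempty. *)
Lemma exists_K_primitive : exists A, K_primitive K A.
Proof.
have [|x ex|f fpos] := @positive_functional _ _ _ hK (codom e).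
- by move=> _ /codomP [i ->].
- have [_ _ /(_ x ex) [i xi _]] := he.
  by exists (e i) => //; exact: codom_f.
have [_ _ _ [u iu]] := hK.
by exists (u *m f); exact: rank_one_K_primitive.
Qed.

Hypotheses (n3 : (3 <= n)%N) (m3 : (3 <= m)%N).
Variable A : 'M[R]_n.
Hypothesis primA : K_primitive K A.

Let hA : cone_preserving K A. Proof. by case: primA. Qed.
Let n0 : (0 < n)%N. Proof. exact: ltn_trans n3. Qed.

Definition index_arc : rel 'I_m := fun i j => `[< dominates K (A *m e i) (e j) >].

Lemma walk_dominates (v : nat -> 'I_m) q :
  (forall j, (j < q)%N -> index_arc (v j) (v j.+1)) ->
  dominates K (A ^+ q *m e (v 0%N)) (e (v q)).
Proof.
elim: q => [_|q IH hv]; first by rewrite expr0 mul1mx; exact: dominates_refl.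
rewrite expmxS; apply: (@dominates_trans _ _ _ cK (A *m e (v q))).
  by apply: dominates_mulmx => //; apply: IH => j jq; apply: hv; exact: ltnW.
by have /asboolP := hv q (ltnSn q).
Qed.

(** * Structure forced by a vertex that is late to reach the interior *)

Section SlowVertex.
Variable i0 : 'I_m.
Hypothesis slow : ~ K° (A ^+ (n.-1 * m.-1) *m e i0).

Lemma slow_lasso j a s : (0 < s)%N -> dominates K (A ^+ a *m e i0) (e j) ->
  dominates K (A ^+ s *m e j) (e j) -> (n.-1 * m.-1 < a + s * n.-1)%N.
Proof.
move=> s0 ij jj; rewrite ltnNge; apply/negP => le; apply: slow.
by apply: (interior_expmx_leq hK primA le) => //; exact: lasso_interior ij jj.
Qed.

(** The orbit has [o] distinct vertices and returns to position [a], a lasso with circuit length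
    [o - a]; slowness and [lasso_length] force [o = m] and [a <= 1]. *)
Lemma selection_orbit t : arc_selection index_arc t ->
  (forall i j, (i < m)%N -> (j < m)%N -> iter i t i0 = iter j t i0 -> i = j) /\
  (iter m t i0 = i0 \/ iter m t i0 = t i0).
Proof.
move=> ht; set o := order t i0.
have om : (o <= m)%N by rewrite -[X in (_ <= X)%N]card_ord max_card.
have /loopingP /(_ o) /trajectP [a ao oa] := looping_order t i0.
have walk j q : dominates K (A ^+ q *m e j) (e (iter q t j)).
  by apply: (@walk_dominates (fun r => iter r t j)) => r _; exact: ht.
have os : iter (o - a) t (iter a t i0) = iter a t i0.
  by rewrite -iterD subnK ?(ltnW ao).
have loop : dominates K (A ^+ (o - a) *m e (iter a t i0)) (e (iter a t i0)).
  by have := walk (iter a t i0) (o - a)%N; rewrite os.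
have oa0 : (0 < o - a)%N by rewrite subn_gt0.
have [om' a1] : o = m /\ (a <= 1)%N := lasso_length n3 ao om (slow_lasso oa0 (walk i0 a) loop).
split=> [i j im jm ij|].
  have := orbit_uniq t i0; rewrite /orbit -/o => /(nth_uniq i0) u.
  have := u i j; rewrite size_traject om' => /(_ im jm).
  by rewrite !nth_traject// ij eqxx => /esym/eqP.
have -> : iter m t i0 = iter a t i0 by rewrite -oa; congr (iter _ t i0).
by case: a a1 {ao oa os loop oa0} => [|[|//]] _; [left | right].
Qed.

(** Otherwise [A] maps each ray from [v 1] onwards onto the next, so the powers of [A] keep
    [e (v 1)] on extreme rays, outside the interior. *)
Lemma selection_branching t : arc_selection index_arc t ->
  exists q (y : 'I_m), [/\ (0 < q)%N, index_arc (iter q t i0) y & y != iter q.+1 t i0].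
Proof.
move=> ht; apply: contrapT => hno; pose v q := iter q t i0.
have uniq_arc q (y : 'I_m) : (0 < q)%N -> index_arc (v q) y -> y = v q.+1.
  move=> q0 qy; apply: contrapT => /eqP ne; apply: hno.
  by exists q, y.
have ray q : (0 < q)%N -> exists2 a : R, 0 < a & A *m e (v q) = a *: e (v q.+1).
  move=> q0; apply: (dominates_unique_extreme hK) => //; first exact: hA.
    by apply/asboolP; exact: ht.
  move=> z ez qz; have [_ _ /(_ z ez) [j zj jz]] := he.
  suff <- : j = v q.+1 by [].
  by apply: uniq_arc => //; apply/asboolP; exact: (dominates_trans cK qz zj).
have rays q : exists2 a : R, 0 < a & A ^+ q *m e (v 1%N) = a *: e (v q.+1).
  elim: q => [|q [a a0 IH]]; first by exists 1; rewrite // expr0 mul1mx scale1r.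
  have [b b0 hb] := ray q.+1 isT.
  by exists (a * b); [exact: mulr_gt0 | rewrite expmxS IH -scalemxAr hb scalerA].
have [_ [p [p0 /(_ _ (Ke (v 1%N)) (e0 _))]]] := primA.
have [a a0 ->] := rays p => ia.
apply: (@extreme_not_interior _ _ _ hK _ (ltnW n3) (ext (v p.+1))).
apply: (dominates_interior hK ia); apply: (dominatesZ) => //; first exact: ltW.
exact: dominates_refl.
Qed.

Lemma slow_vertex_digraph : exists v : nat -> 'I_m,
  [/\ v 0%N = i0,
      forall i j, (i < m)%N -> (j < m)%N -> v i = v j -> i = j,
      forall y : 'I_m, exists2 i, (i < m)%N & y = v i &
      forall i j, (i < m)%N -> (j < m)%N -> index_arc (v i) (v j) <->
        [\/ j = i.+1, i.+1 = m /\ j = 0%N | i.+1 = m /\ j = 1%N]].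
Proof.
apply: (@wielandt_digraph _ index_arc i0 m) => //.
- exact: card_ord.
- move=> i; have [j ij] : exists j, dominates K (A *m e i) (e j).
    apply: dominates_representative; first exact: hA.
    exact: (K_primitive_mulmx_neq0 hK primA).
  by exists j; apply/asboolP.
- by move=> t /selection_orbit [].
- by move=> t /selection_orbit [].
- exact: selection_branching.
Qed.

(** The lasso used steps from [v 0] to [v 1] and then follows the circuit of length [m.-1] that
    skips [v 0]. *)
Lemma slow_vertex_interior : K° (A ^+ (n.-1 * m.-1).+1 *m e i0).
Proof.
have [v [v0 _ _ arcE]] := slow_vertex_digraph.
have arcS j : (j.+1 < m)%N -> index_arc (v j) (v j.+1).
  by move=> jm; apply/arcE; [exact: ltnW | | apply: Or31].
have := @lasso_interior _ _ _ hK _ primA (e i0) (e (v 1%N)) 1 m.-1 n0.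
rewrite mulnC add1n; apply=> //.
- lia.
- by rewrite expr1 -v0; apply/asboolP; apply: arcS; lia.
(* [w] runs through [v 1], ..., [v m.-1] and is back at [v 1] at index [m.-1]. *)
pose w j := if j == m.-1 then v 1%N else v j.+1.
have := @walk_dominates w m.-1; rewrite /w eqxx.
rewrite ifN; last by lia.
apply=> j jm; rewrite ifN; last by lia.
case: eqP => jm'; last by apply: arcS; lia.
by apply/arcE; [lia | lia | apply: Or33; split=> //; lia].
Qed.

End SlowVertex.

Lemma interior_from_representatives p :
  (forall i, K° (A ^+ p *m e i)) -> forall x, K x -> x != 0 -> K° (A ^+ p *m x).
Proof.
move=> h x Kx x0; have [i xi] := dominates_representative Kx x0.
by apply: (dominates_interior hK (h i)); apply: dominates_mulmx => //; exact: cone_preservingX.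
Qed.

Lemma primitive_powers_bound : primitive_powers K A (n.-1 * m.-1).+1.
Proof.
split=> //; apply: interior_from_representatives => i.
have [h|] := pselect (K° (A ^+ (n.-1 * m.-1) *m e i)); last exact: slow_vertex_interior.
by apply: (interior_expmx_leq hK primA _ (Ke i) (e0 i) h).
Qed.

Lemma slow_digraph_iso : ~ primitive_powers K A (n.-1 * m.-1) ->
  digraph_iso (extreme_rays K) (ray_arc K A) [set: 'I_m] (@F1 m).
Proof.
move=> hN; have [i0 slow] : exists i, ~ K° (A ^+ (n.-1 * m.-1) *m e i).
  apply/existsNP => h; apply: hN; split; last exact: interior_from_representatives.
  by rewrite muln_gt0; lia.
have [v [_ vinj vsurj arcE]] := slow_vertex_digraph slow.
pose g (i : 'I_m) := Phi K (e (v i)).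
have ginj i j : g i = g j -> i = j.
  move=> /(extreme_Phi_eq (ext _) (ext _)) ij; have [_ einj _] := he.
  by apply/val_inj/(vinj _ _ (ltn_ord i) (ltn_ord j))/einj.
have gsurj U : extreme_rays K U -> exists i, U = g i.
  case=> x ex <-; have [_ _ /(_ x ex) [j xj _]] := he.
  have [i im ji] := vsurj j; exists (Ordinal im).
  by apply/extreme_Phi_eq => //=; rewrite -ji.
(* [f] inverts [g]; the default [i0] is taken only off the extreme rays. *)
pose f U := xget i0 [set i | U = g i].
have fK i : f (g i) = i by apply: xget_unique => //= j /ginj.
have fE U : extreme_rays K U -> U = g (f U) by move=> /gsurj [i ->]; rewrite fK.
exists f; split.
  split=> [//|U V|i _].
    by rewrite !inE => hU hV /(congr1 g); rewrite -fE// -fE.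
  by exists (g i); [exists (e (v i)) | exact: fK].
move=> U V /gsurj [i ->] /gsurj [j ->]; rewrite !fK /F1 -arcE//.
split=> [[x [y [ex ey ix jy]]]|/asboolP ij].
- have [Kx _ _] := ex; have [Ky _ _] := ey.
  move=> /(PhiS cK (hA Kx) Ky) xy; apply/asboolP.
  apply: (dominates_trans cK (dominates_mulmx hA _)).
    by apply/(extreme_Phi_eq (ext _) ex); exact: ix.
  apply: (dominates_trans cK xy).
  by apply/(extreme_Phi_eq ey (ext _)); rewrite -jy.
- exists (e (v i)), (e (v j)); split=> //.
  by apply/(PhiS cK) => //; exact: hA.
Qed.

End ExtremeRays.

(** * Attained extrema and the bound on the exponent of the cone *)

Lemma is_min_exists (S : set nat) : S !=set0 -> exists p, is_min S p.
Proof.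
move=> [q Sq]; have ex : exists p, `[< S p >] by exists q; apply/asboolP.
case: (ex_minnP ex) => p /asboolP Sp minp; exists p; split=> // r Sr.
by apply: minp; apply/asboolP.
Qed.

Lemma is_max_exists (S : set nat) b : S !=set0 -> ubound S b -> exists p, is_max S p.
Proof.
move=> [q Sq] ub; have ex : exists p, `[< S p >] by exists q; apply/asboolP.
have ub' p : `[< S p >] -> (p <= b)%N by move=> /asboolP; exact: ub.
case: (ex_maxnP ex ub') => p /asboolP Sp maxp; exists p; split=> // r Sr.
by apply: maxp; apply/asboolP.
Qed.

Theorem corollary4p9 (R : realType) (n m k : nat) (hn : (3 <= n)%N)
    (hnm : (n <= m)%N) (hk : m = (n + k)%N)
    (K : set 'cV[R]_n) (hK : polyhedral_cone m K) :
  [/\ is_max (exponents K) (cone_exponent K),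
      (cone_exponent K)%:Z <= (n%:Z - 1) * (m%:Z - 1) + 1,
      (n%:Z - 1) * (m%:Z - 1) + 1
        = m%:Z ^+ 2 - (k%:Z + 2) * m%:Z + k%:Z + 2 &
      (cone_exponent K)%:Z = (n%:Z - 1) * (m%:Z - 1) + 1 ->
      exists A : 'M[R]_n, K_primitive K A /\
        digraph_iso (extreme_rays K) (ray_arc K A) [set: 'I_m] (@F1 m)].
Proof.
have [pK cardK] := hK.
have [e he] := exists_ray_representatives pK cardK.
have m3 := leq_trans hn hnm.
(* Primitivity supplies a power, so the default in [exponent] is not taken. *)
have minE A : K_primitive K A -> is_min (primitive_powers K A) (exponent K A).
  by move=> [_ /is_min_exists]; exact: xgetPex.
have bound : ubound (exponents K) (n.-1 * m.-1).+1.
  move=> _ [A primA <-]; have [_] := minE A primA; apply.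
  exact: primitive_powers_bound he _ _ _ primA.
have maxE : is_max (exponents K) (cone_exponent K).
  apply: xgetPex; apply: is_max_exists bound.
  have [A primA] := exists_K_primitive pK he.
  by exists (exponent K A); exists A.
have boundE : (n%:Z - 1) * (m%:Z - 1) + 1 = ((n.-1 * m.-1).+1)%:Z.
  by rewrite -addn1 PoszD PoszM !predn_int //; lia.
split=> //.
- by rewrite boundE lez_nat; case: maxE => [+ _]; exact: bound.
- by rewrite hk PoszD; ring.
(* A matrix attaining the maximum has least power (n - 1)(m - 1) + 1, so its power (n - 1)(m - 1)
   fails and some representative is slow. *)
rewrite boundE => -[eqN]; have [[A primA expA] _] := maxE.
exists A; split=> //; apply: (slow_digraph_iso pK he) => // hN.
by have [_ /(_ _ hN)] := minE A primA; rewrite expA eqN leEnat ltnn.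
Qed.
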